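(* Let $G$ be an abelian group and let $R$ be a $G$-graded, gr-prime, right gr-Goldie ring. Then $R$ has a gr-simple, gr-artinian right ring of fractions. Explicitly: the set $\mathcal{E}$ of homogeneous regular elements of $R$ is a right denominator set, and the right ring of fractions $R[\mathcal{E}^{-1}]$, equipped with the unique $G$-grading extending that of $R$, is a gr-simple, gr-artinian ring.
   Context: Rings are associative with identity. A $G$-graded ring is a ring $R=\bigoplus_{g\in G}R_g$ with $R_gR_h\subseteq R_{gh}$ for all $g,h\in G$; elements of $\bigcup_g R_g$ are called homogeneous, and a (right, left or two-sided) ideal is graded if it is generated by homogeneous elements. The prefix ''gr-'' denotes the graded analogue of a standard notion: - $R$ is gr-prime if $R\neq 0$ and $IJ\neq 0$ for all nonzero graded two-sided ideals $I,J$ of $R$. - $R$ is right gr-Goldie if $R$ contains no infinite direct sum of nonzero graded right ideals (finite gr-uniform dimension) and $R$ satisfies the ascending chain condition on right annihilators of sets of homogeneous elements. - A graded ring is gr-simple if it is nonzero and its only graded two-sided ideals are $0$ and the whole ring. - A graded ring is gr-artinian if it satisfies the descending chain condition on graded right ideals and on graded left ideals. An element is regular if it is neither a left nor a right zero divisor. The right ring of fractions is taken with denominators that are homogeneous regular elements of $R$, so its elements have the form $rc^{-1}$ with $r\in R$ and $c$ homogeneous regular, and the $G$-grading on $R$ extends uniquely to it. *)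

(* Defs.v *)
From HB Require Import structures.
From mathcomp Require Import all_boot all_order all_algebra.
From mathcomp Require Import classical_sets.

Set Implicit Arguments.
Unset Strict Implicit.
Unset Printing Implicit Defensive.

Import GRing.Theory.
Local Open Scope classical_set_scope.
Local Open Scope ring_scope.

(* The abelian group G is written additively, and a G-grading of a ring R is  *)
(* given by its family of components A : G -> set R.                          *)

Definition add_subgroup (V : zmodType) (B : set V) : Prop :=
  B 0 /\ (forall x y, B x -> B y -> B (x - y)).

(* The sum of the subgroups A i is direct. *)
Definition independent (V : zmodType) (I : eqType) (A : I -> set V) : Prop :=
  forall (s : seq I) (f : I -> V), uniq s ->
    (forall i, i \in s -> A i (f i)) ->
    \sum_(i <- s) f i = 0 -> forall i, i \in s -> f i = 0.

Definition spanning (V : zmodType) (I : eqType) (A : I -> set V) : Prop :=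
  forall x : V, exists (s : seq I) (f : I -> V),
    [/\ uniq s, forall i, i \in s -> A i (f i) & x = \sum_(i <- s) f i].

Definition is_grading (G : zmodType) (R : pzRingType) (A : G -> set R) : Prop :=
  [/\ forall g, add_subgroup (A g), independent A, spanning A
    & forall g h x y, A g x -> A h y -> A (g + h) (x * y)].

Definition homogeneous (G : zmodType) (R : pzRingType) (A : G -> set R) : set R :=
  \bigcup_g A g.

Definition right_ideal (R : pzRingType) (I : set R) : Prop :=
  add_subgroup I /\ (forall x r, I x -> I (x * r)).

Definition left_ideal (R : pzRingType) (I : set R) : Prop :=
  add_subgroup I /\ (forall x r, I x -> I (r * x)).

Definition two_sided_ideal (R : pzRingType) (I : set R) : Prop :=
  right_ideal I /\ left_ideal I.

(* [ideal] is one of right_ideal, left_ideal, two_sided_ideal, and            *)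
(* [smallest ideal S] is then the ideal of that kind generated by S.          *)
Definition graded (G : zmodType) (R : pzRingType) (A : G -> set R)
    (ideal : set (set R)) (I : set R) : Prop :=
  ideal I /\ exists2 S : set R, S `<=` homogeneous A & I = smallest ideal S.

Definition ideal_mul (R : pzRingType) (I J : set R) : set R :=
  smallest (@add_subgroup R) [set x * y | x in I & y in J].

Definition gr_prime (G : zmodType) (R : pzRingType) (A : G -> set R) : Prop :=
  [set: R] <> [set 0] /\
  forall I J : set R,
    graded A (@two_sided_ideal R) I -> graded A (@two_sided_ideal R) J ->
    I <> [set 0] -> J <> [set 0] -> ideal_mul I J <> [set 0].

Definition acc (T : Type) (P : set (set T)) : Prop :=
  forall C : nat -> set T, (forall n, P (C n)) ->
    (forall n, C n `<=` C n.+1) ->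
    exists N, forall n, (N <= n)%N -> C n = C N.

Definition dcc (T : Type) (P : set (set T)) : Prop :=
  forall C : nat -> set T, (forall n, P (C n)) ->
    (forall n, C n.+1 `<=` C n) ->
    exists N, forall n, (N <= n)%N -> C n = C N.

Definition right_annihilator (R : pzRingType) (S : set R) : set R :=
  [set x | forall s, S s -> s * x = 0].

(* Every infinite direct sum contains a countably infinite one, so it is      *)
(* enough to exclude families indexed by nat.                                 *)
Definition finite_gr_uniform_dim (G : zmodType) (R : pzRingType)
    (A : G -> set R) : Prop :=
  ~ exists I : nat -> set R,
      [/\ forall n, graded A (@right_ideal R) (I n),
          forall n, I n <> [set 0]
        & independent I].

Definition right_gr_goldie (G : zmodType) (R : pzRingType)
    (A : G -> set R) : Prop :=
  finite_gr_uniform_dim A /\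
  acc [set right_annihilator S | S in [set S : set R | S `<=` homogeneous A]].

Definition gr_simple (G : zmodType) (R : pzRingType) (A : G -> set R) : Prop :=
  [set: R] <> [set 0] /\
  forall I : set R, graded A (@two_sided_ideal R) I ->
    I = [set 0] \/ I = [set: R].

Definition gr_artinian (G : zmodType) (R : pzRingType) (A : G -> set R) : Prop :=
  dcc (graded A (@right_ideal R)) /\ dcc (graded A (@left_ideal R)).

Definition homogeneous_regular (G : zmodType) (R : pzRingType)
    (A : G -> set R) : set R :=
  [set c | [/\ homogeneous A c, GRing.lreg c & GRing.rreg c]].

(* The last two conditions are the right Ore condition and right              *)
(* reversibility.                                                             *)
Definition right_denominator_set (R : pzRingType) (E : set R) : Prop :=
  [/\ E 1,
      forall c d, E c -> E d -> E (c * d),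
      forall r c, E c -> exists s d, E d /\ r * d = c * s
    & forall r c, E c -> c * r = 0 -> exists2 d, E d & r * d = 0].

(* (Q, phi) is the right ring of fractions R[E^-1]. *)
Definition right_ring_of_fractions (R : pzRingType) (E : set R)
    (Q : unitRingType) (phi : {rmorphism R -> Q}) : Prop :=
  [/\ forall c, E c -> phi c \is a GRing.unit,
      forall q : Q, exists r c, E c /\ q = phi r / phi c
    & forall r, phi r = 0 <-> exists2 c, E c & r * c = 0].

Definition extends_grading (G : zmodType) (R Q : pzRingType) (phi : R -> Q)
    (A : G -> set R) (B : G -> set Q) : Prop :=
  forall g, phi @^-1` (B g) = A g.

(* Main.v *)
Require Import Defs.
From HB Require Import structures.
From mathcomp Require Import all_boot all_order all_algebra.
From mathcomp Require Import generic_quotient boolp classical_sets.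

Set Implicit Arguments.
Unset Strict Implicit.
Unset Printing Implicit Defensive.

Import GRing.Theory.
Local Open Scope quotient_scope.
Local Open Scope classical_set_scope.
Local Open Scope ring_scope.

(** Goldie's theorem produces a regular element of an essential right ideal as
    a sum of elements of independent right ideals.  In the graded setting such
    a sum is homogeneous only if its terms have the same degree, and this is where
    the commutativity of G enters: the cyclic permutations of a product of
    homogeneous elements all have the same degree.

    Let I be an essential graded right ideal of R.  By the chain condition one finds
    elements a of I with maximal annihilators and multipliers y, one pair at
    a time, such that left multiplication by ay is injective on aR and kills all the
    elements a found later.  The right ideals aR are then independent, so the search
    stops ([ladder_exhausts]), and the common annihilator of the elements ay is 0.
    Since R is gr-prime there is one nonzero product W that has every aya as
    a factor, and some x with WxW not 0.  For each pair, the factors of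
    Wx can be permuted cyclically into an element azay with aza not 0.  By maximality
    azay has the annihilator of ay.  All the azay have the degree of Wx, and their
    sum c, a homogeneous element of I, has annihilator 0
    ([essential_has_nonzero_divisor]).  Then cR is essential, and c is not a right
    zero divisor either, because the annihilator of a nonzero homogeneous element
    is never essential ([annihilator_not_essential]).

    The Ore condition follows: for every r the elements v with rv in cR form a right
    ideal that contains an essential graded one, hence a homogeneous regular element.
    The ring of fractions is built as a ring of germs of right linear maps.

    In a ring of fractions Q the fractions of homogeneous elements define the
    grading.  A nonzero graded ideal of Q meets R in an essential right ideal, hence
    contains a unit, and Q is gr-simple.  In the same way no graded right ideal of
    Q is essential in a larger one ([fraction_semisimple]).  Together with the
    finiteness of the uniform dimension this gives both chain conditions on
    graded right ideals; they make Q graded von Neumann regular, every graded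
    left ideal has the form Qe with e idempotent, and such left ideals are
    determined by their right annihilators, whence the chain condition on the left
    ([semisimple_artinian]). *)

(** * Subgroups, independent families and chain conditions *)

Section Subgroups.

Variables (V : zmodType) (B : set V).
Hypothesis subB : add_subgroup B.

Lemma subgroup0 : B 0. Proof. by case: subB. Qed.

Lemma subgroupB x y : B x -> B y -> B (x - y). Proof. by case: subB => _; apply. Qed.

Lemma subgroupN x : B x -> B (- x).
Proof. by move=> Bx; rewrite -sub0r; apply: subgroupB => //; apply: subgroup0. Qed.

Lemma subgroupD x y : B x -> B y -> B (x + y).
Proof. by move=> Bx By; rewrite -[y]opprK; apply: subgroupB => //; apply: subgroupN. Qed.

Lemma subgroup_sum (I : eqType) (s : seq I) (f : I -> V) :
  (forall i, i \in s -> B (f i)) -> B (\sum_(i <- s) f i).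
Proof.
move=> Bf; rewrite big_seq.
by apply: (big_ind B subgroup0 subgroupD) => i /Bf.
Qed.

End Subgroups.

Lemma nonzero_elt (V : zmodType) (B : set V) :
  add_subgroup B -> B <> [set 0] -> exists2 x, B x & x != 0.
Proof.
move=> subB nzB; apply: contrapT => no; apply: nzB; apply/seteqP; split=> x /=.
  by move=> Bx; apply: contrapT => /eqP nz; apply: no; exists x.
by move->; apply: subgroup0.
Qed.

Lemma nonzero_of_elt (V : zmodType) (B : set V) x : B x -> x != 0 -> B <> [set 0].
Proof. by move=> Bx nz B0; move: Bx nz; rewrite B0 => ->; rewrite eqxx. Qed.

(** In a vanishing sum the first nonzero term, for any total order on the
    indices, is minus a sum of later ones.  The usual order serves descending
    chains, the reverse order ascending ones. *)
Lemma independent_of_order (V : zmodType) (T : eqType) (le : rel T)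
    (B D : T -> set V) :
  total le -> transitive le -> (forall i, add_subgroup (D i)) ->
  (forall i j, le i j -> i != j -> B j `<=` D i) ->
  (forall i x, B i x -> D i x -> x = 0) ->
  independent B.
Proof.
move=> tot trans subD BD BD0 s f us Bf sum0 i0 i0s.
apply/eqP; apply: contrapT => /negP nz0.
pose s' := sort le [seq j <- s | f j != 0].
have us' : uniq s' by rewrite sort_uniq filter_uniq.
have in_s' j : j \in s' = (f j != 0) && (j \in s) by rewrite mem_sort mem_filter.
have sum0' : \sum_(j <- s') f j = 0.
  apply: etrans sum0; rewrite (perm_big [seq j <- s | f j != 0]) /=; last by rewrite perm_sort.
  rewrite big_filter big_mkcond /=; apply: eq_bigr => j _.
  by case: eqVneq.
have : i0 \in s' by rewrite in_s' nz0.
have := sort_sorted tot [seq j <- s | f j != 0]; rewrite -/s'.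
case: s' us' in_s' sum0' => // i t /= /andP[it ut] in_s' sum0' srt _.
have /andP[nzi is_] : (f i != 0) && (i \in s) by rewrite -in_s' inE eqxx.
move/negP: nzi; apply; apply/eqP; apply: (BD0 i) => //; first exact: Bf.
move: sum0'; rewrite big_cons => /eqP; rewrite addr_eq0 => /eqP ->.
apply: subgroupN (subD i) _ _; apply: (subgroup_sum (subD i)) => j jt.
apply: (BD i j).
- by move: srt; rewrite (path_sortedE trans) => /andP[/allP /(_ j jt)].
- by apply: contraNneq it => ->.
- by apply: Bf; have := in_s' j; rewrite inE jt orbT => /esym /andP[].
Qed.

(** A sequence that never stabilizes has a subsequence without equal neighbours. *)
Lemma chain_stabilizes (T : Type) (C : nat -> set T) :
  (forall u : nat -> nat, (forall k, (u k < u k.+1)%N) ->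
    exists k, C (u k) = C (u k.+1)) ->
  exists N, forall n, (N <= n)%N -> C n = C N.
Proof.
move=> nostrict; apply: contrapT => unstable.
have next N : exists n, (N < n)%N /\ C n <> C N.
  apply: contrapT => no; apply: unstable; exists N => n.
  rewrite leq_eqVlt => /predU1P[-> //|ltNn].
  by apply: contrapT => neq; apply: no; exists n.
have [nxt nxtP] := choice next.
have [k] : exists k, C (iter k nxt 0%N) = C (iter k.+1 nxt 0%N).
  by apply: nostrict => k; have [] := nxtP (iter k nxt 0%N).
by move=> eqC; have [_] := nxtP (iter k nxt 0%N); rewrite -iterS -eqC.
Qed.

Lemma ascending_chain (T : Type) (C : nat -> set T) :
  (forall n, C n `<=` C n.+1) -> forall m n, (m <= n)%N -> C m `<=` C n.
Proof.
move=> inc m; elim=> [|n IHn]; first by rewrite leqn0 => /eqP->.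
by rewrite leq_eqVlt => /predU1P[-> //|/IHn sub] x /sub /inc.
Qed.

Lemma descending_chain (T : Type) (C : nat -> set T) :
  (forall n, C n.+1 `<=` C n) -> forall m n, (m <= n)%N -> C n `<=` C m.
Proof.
move=> dec m; elim=> [|n IHn]; first by rewrite leqn0 => /eqP->.
by rewrite leq_eqVlt => /predU1P[-> //|/IHn sub] x /dec /sub.
Qed.

Lemma dependent_sequence (T : Type) (P : T -> Prop) (S : T -> T -> Prop) x0 :
  P x0 -> (forall x, P x -> exists2 y, P y & S x y) ->
  exists u : nat -> T, forall n, P (u n) /\ S (u n) (u n.+1).
Proof.
move=> Px0 ext.
have ext' (x : {x | P x}) : exists y : {x | P x}, S (sval x) (sval y).
  by case: x => x Px; have [y Py Sxy] := ext x Px; exists (exist _ y Py).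
have [nxt nxtP] := choice ext'.
exists (fun n => sval (iter n nxt (exist _ x0 Px0))) => n.
by split; [apply: (svalP (iter n nxt _)) | apply: nxtP].
Qed.

Lemma acc_maximal (T U : Type) (F : U -> set T) (C : set (set T)) (P : U -> Prop) :
  acc C -> (forall x, P x -> C (F x)) -> (exists x, P x) ->
  exists2 x, P x & forall y, P y -> F x `<=` F y -> F y = F x.
Proof.
move=> accC PC [x0 Px0]; apply: contrapT => nomax.
have ext x : P x -> exists2 y, P y & (F x `<=` F y /\ F y <> F x).
  move=> Px; apply: contrapT => no; apply: nomax; exists x => // y Py xy.
  by apply: contrapT => neq; apply: no; exists y.
have [u uP] := dependent_sequence Px0 ext.
have [|n|N NP] := accC (F \o u).
- by move=> n; apply: PC; case: (uP n).
- by case: (uP n) => _ [].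
by case: (uP N) => _ [_]; apply; apply: NP.
Qed.

(** * Homogeneous components *)

Lemma sum_supported (V : zmodType) (I : eqType) (s u : seq I) (f : I -> V) :
  uniq s -> uniq u -> {subset s <= u} -> (forall i, i \notin s -> f i = 0) ->
  \sum_(i <- u) f i = \sum_(i <- s) f i.
Proof.
move=> us uu su f0; rewrite (bigID (mem s)) /= addrC big1 ?add0r; last by move=> i /f0.
rewrite -big_filter; apply: perm_big; apply: uniq_perm => //; first exact: filter_uniq.
move=> i; rewrite mem_filter; apply/andP/idP => [[]//|is_]; split=> //; exact: su.
Qed.

Definition decomposition (G : zmodType) (R : pzRingType) (A : G -> set R) (x : R)
    (F : G -> R) : Prop :=
  (forall g, A g (F g)) /\
  exists s, [/\ uniq s, forall g, g \notin s -> F g = 0 & x = \sum_(g <- s) F g].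

Definition component (G : zmodType) (R : pzRingType) (A : G -> set R) (x : R) : G -> R :=
  xget (fun=> 0) (decomposition A x).

Definition component_closed (G : zmodType) (R : pzRingType) (A : G -> set R)
    (I : set R) : Prop :=
  forall x g, I x -> I (component A x g).

Section Grading.

Variables (G : zmodType) (R : pzRingType) (A : G -> set R).
Hypothesis gA : is_grading A.

Lemma grading_subgroup g : add_subgroup (A g). Proof. by case: gA. Qed.

Lemma gradingM g h x y : A g x -> A h y -> A (g + h) (x * y).
Proof. by case: gA => _ _ _; apply. Qed.

Let A0 g : A g 0. Proof. exact: subgroup0 (grading_subgroup g). Qed.

Lemma homogeneousM x y : homogeneous A x -> homogeneous A y -> homogeneous A (x * y).
Proof. by move=> [g _ Ax] [h _ Ay]; exists (g + h) => //; apply: gradingM. Qed.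

Lemma decomposition_uniq x F F' :
  decomposition A x F -> decomposition A x F' -> F =1 F'.
Proof.
move=> [AF [s [us s0 xs]]] [AF' [s' [us' s0' xs']]] g.
pose u := undup (g :: s ++ s').
have uu : uniq u by apply: undup_uniq.
have ind : forall i, i \in u -> (F i - F' i) = 0.
  case: gA => _ indA _ _; apply: (indA u (fun i => F i - F' i)) => //.
    by move=> i _; apply: subgroupB (grading_subgroup i) _ _ _ _.
  rewrite big_split sumrN /=.
  rewrite (sum_supported us uu _ s0) -?xs ?(sum_supported us' uu _ s0') -?xs' ?subrr //.
    by move=> i is_; rewrite mem_undup inE mem_cat is_ !orbT.
  by move=> i is_; rewrite mem_undup inE mem_cat is_ !orbT.
by apply/eqP; rewrite -subr_eq0 ind // mem_undup inE eqxx.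
Qed.

Lemma componentP x : decomposition A x (component A x).
Proof.
rewrite /component; apply: xgetPex; case: gA => _ _ span _.
have [s [f [us Af ->]]] := span x.
exists (fun g => if g \in s then f g else 0); split.
  by move=> g; case: ifP => [/Af//|_]; apply: A0.
exists s; split=> // [g /negbTE -> //|].
by rewrite big_seq [RHS]big_seq; apply: eq_bigr => i ->.
Qed.

Lemma componentE x F : decomposition A x F -> component A x =1 F.
Proof. exact: decomposition_uniq (componentP x). Qed.

Lemma component_in x g : A g (component A x g).
Proof. by case: (componentP x). Qed.

Lemma component_homogeneous x g : homogeneous A (component A x g).
Proof. by exists g => //; apply: component_in. Qed.

Lemma component_hom g h x : A g x -> component A x h = if h == g then x else 0.
Proof.
move=> Ax.
rewrite (@componentE x (fun i => if i == g then x else 0)) //; split.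
  by move=> i; case: eqP => [->//|_]; apply: A0.
exists [:: g]; split=> //; last by rewrite big_seq1 eqxx.
by move=> i; rewrite inE => /negbTE ->.
Qed.

Lemma component_subset (I : set R) x g :
  I 0 -> homogeneous A x -> I x -> I (component A x g).
Proof. by move=> I0 [h _ Ax] Ix; rewrite (component_hom _ Ax); case: eqP. Qed.

Lemma componentB x y g :
  component A (x - y) g = component A x g - component A y g.
Proof.
rewrite (@componentE _ (fun g => component A x g - component A y g)) //; split.
  by move=> i; apply: subgroupB (grading_subgroup i) _ _ _ _; apply: component_in.
have [_ [s [us s0 xs]]] := componentP x; have [_ [t [ut t0 yt]]] := componentP y.
exists (undup (s ++ t)); split; first exact: undup_uniq.
  by move=> i; rewrite mem_undup mem_cat negb_or => /andP[/s0 -> /t0 ->]; rewrite subrr.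
rewrite big_split sumrN /= {1}xs {1}yt; congr (_ - _); apply/esym.
  apply: sum_supported => //; first exact: undup_uniq.
  by move=> i is_; rewrite mem_undup mem_cat is_.
apply: sum_supported => //; first exact: undup_uniq.
by move=> i it; rewrite mem_undup mem_cat it orbT.
Qed.

Lemma component0 g : component A 0 g = 0.
Proof. by rewrite -[0 in LHS](subrr 0) componentB subrr. Qed.

Lemma componentD x y g :
  component A (x + y) g = component A x g + component A y g.
Proof.
by rewrite -{1}[y]opprK -{1}[- y]sub0r !componentB component0 sub0r opprK.
Qed.

Lemma component_mulr h x y g :
  A h y -> component A (x * y) g = component A x (g - h) * y.
Proof.
move=> Ay; rewrite (@componentE _ (fun g => component A x (g - h) * y)) //; split.
  by move=> i; rewrite -{1}(subrK h i); apply: gradingM => //; apply: component_in.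
have [_ [s [us s0 xs]]] := componentP x.
exists (map (+%R^~ h) s); split.
- by rewrite map_inj_uniq //; apply: addIr.
- move=> i; rewrite -{1}(subrK h i) (mem_map (addIr h)) => /s0 ->.
  by rewrite mul0r.
by rewrite big_map {1}xs mulr_suml; apply: eq_bigr => i _; rewrite addrK.
Qed.

Lemma component_mull h x y g :
  A h y -> component A (y * x) g = y * component A x (g - h).
Proof.
move=> Ay; rewrite (@componentE _ (fun g => y * component A x (g - h))) //; split.
  by move=> i; rewrite -{1}(subrKC h i); apply: gradingM => //; apply: component_in.
have [_ [s [us s0 xs]]] := componentP x.
exists (map (+%R^~ h) s); split.
- by rewrite map_inj_uniq //; apply: addIr.
- move=> i; rewrite -{1}(subrK h i) (mem_map (addIr h)) => /s0 ->.
  by rewrite mulr0.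
by rewrite big_map {1}xs mulr_sumr; apply: eq_bigr => i _; rewrite addrK.
Qed.

Lemma homogeneous_ind (P : R -> Prop) :
  P 0 -> (forall x y, P x -> P y -> P (x + y)) ->
  (forall x, homogeneous A x -> P x) -> forall x, P x.
Proof.
move=> P0 PD Phom x; have [_ [s [_ _ ->]]] := componentP x.
by apply: big_ind => // i _; apply/Phom/component_homogeneous.
Qed.

Lemma of_components (I : set R) x :
  add_subgroup I -> (forall g, I (component A x g)) -> I x.
Proof.
move=> subI Ix; have [_ [s [_ _ ->]]] := componentP x.
exact: subgroup_sum.
Qed.

Lemma components_eq0 x : (forall g, component A x g = 0) -> x = 0.
Proof.
move=> x0; have [_ [s [_ _ ->]]] := componentP x.
by apply: big1.
Qed.

Lemma component_neq0 x : x != 0 -> exists g, component A x g != 0.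
Proof.
move=> nz; apply: contrapT => no; move/negP: nz; apply; apply/eqP.
by apply: components_eq0 => g; apply: contrapT => /eqP nz; apply: no; exists g.
Qed.

Lemma in_grading g x : (forall h, h != g -> component A x h = 0) -> A g x.
Proof.
move=> x0; rewrite (_ : x = component A x g); first exact: component_in.
apply/eqP; rewrite -subr_eq0; apply/eqP; apply: components_eq0 => h.
rewrite componentB (component_hom _ (component_in x g)).
by case: eqVneq => [->|/x0 ->]; rewrite subrr.
Qed.

(** The degree zero component of 1 is a left unit for homogeneous elements,
    hence for all elements. *)
Lemma grading1 : A 0 1.
Proof.
suff e1 : forall x, component A 1 0 * x = x.
  by rewrite -[1](e1 1) mulr1; apply: component_in.
apply: homogeneous_ind => [|x y ex ey|x [h _ Ax]].
- by rewrite mulr0.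
- by rewrite mulrDr ex ey.
have := component_hom h Ax; rewrite eqxx => {2}<-.
by rewrite -{2}[x]mul1r (component_mulr _ _ Ax) subrr.
Qed.

Lemma homogeneous1 : homogeneous A 1.
Proof. by exists 0 => //; apply: grading1. Qed.

Lemma grading_cancelr g h x c : A h c -> GRing.rreg c -> A (g + h) (x * c) -> A g x.
Proof.
move=> Ac regc Axc; apply: in_grading => k nkg; apply: regc => /=; rewrite mul0r.
have := component_mulr x (k + h) Ac; rewrite addrK => <-.
by rewrite (component_hom _ Axc) (inj_eq (addIr h)) (negbTE nkg).
Qed.

Lemma grading_cancell g h x c : A h c -> GRing.lreg c -> A (g + h) (c * x) -> A g x.
Proof.
move=> Ac regc Axc; apply: in_grading => k nkg; apply: regc => /=; rewrite mulr0.
have := component_mull x (k + h) Ac; rewrite addrK => <-.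
by rewrite (component_hom _ Axc) (inj_eq (addIr h)) (negbTE nkg).
Qed.

Lemma degree_uniq g h x : x != 0 -> A g x -> A h x -> g = h.
Proof.
move=> nz Agx Ahx; have := component_hom g Ahx.
rewrite (component_hom g Agx) eqxx; case: eqP => // _ x0.
by rewrite x0 eqxx in nz.
Qed.

(** * Graded ideals *)

(** A graded ideal is the smallest ideal containing some homogeneous elements.  It
    is closed under components because its elements with all components in it
    form an ideal of the same kind. *)

Let core (I : set R) : set R := [set x | I x /\ forall g, I (component A x g)].

Let core_subgroup I : add_subgroup I -> add_subgroup (core I).
Proof.
move=> subI; split=> [|x y [Ix Cx] [Iy Cy]].
  by split=> [|g]; rewrite ?component0; apply: subgroup0.
by split=> [|g]; rewrite ?componentB; apply: subgroupB.
Qed.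

Let core_right I : right_ideal I -> right_ideal (core I).
Proof.
move=> [subI mulI]; split=> [|x r [Ix Cx]]; first exact: core_subgroup.
split=> [|g]; first exact: mulI.
elim/homogeneous_ind: r g => [g|r1 r2 IH1 IH2 g|r [h _ Ar] g].
- by rewrite mulr0 component0; apply: subgroup0.
- by rewrite mulrDr componentD; apply: subgroupD.
- by rewrite (component_mulr _ _ Ar); apply: mulI.
Qed.

Let core_left I : left_ideal I -> left_ideal (core I).
Proof.
move=> [subI mulI]; split=> [|x r [Ix Cx]]; first exact: core_subgroup.
split=> [|g]; first exact: mulI.
elim/homogeneous_ind: r g => [g|r1 r2 IH1 IH2 g|r [h _ Ar] g].
- by rewrite mul0r component0; apply: subgroup0.
- by rewrite mulrDl componentD; apply: subgroupD.
- by rewrite (component_mull _ _ Ar); apply: mulI.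
Qed.

Let core_closed (ideal : set (set R)) I :
  (forall J, ideal J -> add_subgroup J) -> (ideal I -> ideal (core I)) ->
  graded A ideal I -> component_closed A I.
Proof.
move=> sub idcore [idI [S homS eqI]] x g Ix.
suff : core I x by case.
have idC := idcore idI; move: (Ix); rewrite {1}eqI; apply; split=> //= y Sy.
have Iy : I y by rewrite eqI => M [_]; apply.
split=> // h; apply: component_subset => //; last exact: homS.
by apply: subgroup0; apply: sub.
Qed.

Lemma graded_right_closed I : graded A (@right_ideal R) I -> component_closed A I.
Proof. exact: core_closed (fun J => @proj1 _ _) (@core_right I). Qed.

Lemma graded_left_closed I : graded A (@left_ideal R) I -> component_closed A I.
Proof. exact: core_closed (fun J => @proj1 _ _) (@core_left I). Qed.

Lemma graded_two_sided_closed I :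
  graded A (@two_sided_ideal R) I -> component_closed A I.
Proof.
apply: core_closed => [J [[]]|[rI lI]] //.
by split; [apply: core_right | apply: core_left].
Qed.

Lemma closed_graded (ideal : set (set R)) I :
  (forall J, ideal J -> add_subgroup J) -> ideal I -> component_closed A I ->
  graded A ideal I.
Proof.
move=> sub idI clI; split=> //; exists (I `&` homogeneous A) => [x []//|].
apply/seteqP; split=> [x Ix M [/sub subM IM]|]; last by apply: smallest_sub => // x [].
apply: of_components => // g; apply: IM.
by split; [apply: clI | apply: component_homogeneous].
Qed.

End Grading.

(** * Gr-prime rings and essential right ideals *)

Definition graded_right_ideal (G : zmodType) (R : pzRingType) (A : G -> set R)
    (I : set R) : Prop :=
  right_ideal I /\ component_closed A I.

Definition essential (G : zmodType) (R : pzRingType) (A : G -> set R)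
    (T : set R) : Prop :=
  forall x, homogeneous A x -> x != 0 -> exists r, T (x * r) /\ x * r != 0.

Definition no_infinite_direct_sum (G : zmodType) (R : pzRingType)
    (A : G -> set R) : Prop :=
  forall a : nat -> R, (forall n, homogeneous A (a n)) -> (forall n, a n != 0) ->
    ~ independent (fun n => range ( *%R (a n))).

Lemma range_mul_right_ideal (R : pzRingType) (a : R) : right_ideal (range ( *%R a)).
Proof.
split=> [|x r [t _ <-]]; last by exists (t * r); rewrite ?mulrA.
split=> [|x y [t _ <-] [t' _ <-]]; first by exists 0; rewrite ?mulr0.
by exists (t - t'); rewrite ?mulrBr.
Qed.

Lemma range_mul_closed (G : zmodType) (R : pzRingType) (A : G -> set R) (a : R) :
  is_grading A -> homogeneous A a -> component_closed A (range ( *%R a)).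
Proof.
move=> gA [h _ Aa] x g [t _ <-].
by rewrite (component_mull gA _ _ Aa); exists (component A t (g - h)).
Qed.

Lemma finite_uniform_dim_range (G : zmodType) (R : pzRingType) (A : G -> set R) :
  is_grading A -> finite_gr_uniform_dim A -> no_infinite_direct_sum A.
Proof.
move=> gA fudA a homa nza ind; apply: fudA.
exists (fun n => range ( *%R (a n))); split=> // n.
  apply: closed_graded => //; first by move=> J [].
    exact: range_mul_right_ideal.
  exact: range_mul_closed.
by apply: nonzero_of_elt (nza n); exists 1; rewrite ?mulr1.
Qed.

(** If xzy = 0 for all homogeneous z, hence for all z, the product of the ideals
    generated by x and y is zero. *)
Lemma gr_prime_elements (G : zmodType) (R : pzRingType) (A : G -> set R) (x y : R) :
  is_grading A -> gr_prime A -> homogeneous A x -> homogeneous A y ->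
  x != 0 -> y != 0 -> exists2 z, homogeneous A z & x * z * y != 0.
Proof.
move=> gA [_ primeA] homx homy nzx nzy; apply: contrapT => no.
have xzy z : x * z * y = 0.
  elim/(homogeneous_ind gA): z => [|z t xz xt|z homz].
  - by rewrite mulr0 mul0r.
  - by rewrite mulrDr mulrDl xz xt addr0.
  - by apply: contrapT => /eqP nz; apply: no; exists z.
pose ideal_gen a := smallest (@two_sided_ideal R) [set a].
have idg a : two_sided_ideal (ideal_gen a).
  split; (split; first split).
  - by move=> M [[[[]]]].
  - by move=> u v Iu Iv M /[dup] -[[[[_ sub] _] _] _] MM; apply: sub; [apply: Iu|apply: Iv].
  - by move=> u r Iu M /[dup] -[[[_ mulM] _] _] MM; apply: mulM; apply: Iu.
  - by move=> M [[[[]]]].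
  - by move=> u v Iu Iv M /[dup] -[[[[_ sub] _] _] _] MM; apply: sub; [apply: Iu|apply: Iv].
  - by move=> u r Iu M /[dup] -[[_ [_ mulM]] _] MM; apply: mulM; apply: Iu.
have memg a : ideal_gen a a by apply: sub_gen_smallest.
have grg a : homogeneous A a -> graded A (@two_sided_ideal R) (ideal_gen a).
  by move=> homa; split=> //; exists [set a] => // b ->.
have left0 u : ideal_gen x u -> forall z, u * z * y = 0.
  move: u; apply: smallest_sub => [|u -> //]; split; split=> /=.
  - by split=> [z|u v Hu Hv z]; rewrite ?mul0r // !mulrBl Hu Hv subrr.
  - by move=> u r Hu z; rewrite -(mulrA u).
  - by split=> [z|u v Hu Hv z]; rewrite ?mul0r // !mulrBl Hu Hv subrr.
  - by move=> u r Hu z; rewrite -!mulrA (mulrA u) Hu mulr0.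
have prod0 v : ideal_gen y v -> forall u, ideal_gen x u -> forall z, u * z * v = 0.
  move: v; apply: smallest_sub => [|v -> //]; split; split=> /=.
  - by split=> [u Iu z|v w Hv Hw u Iu z]; rewrite ?mulr0 // !mulrBr Hv // Hw // subrr.
  - by move=> v r Hv u Iu z; rewrite mulrA Hv // mul0r.
  - by split=> [u Iu z|v w Hv Hw u Iu z]; rewrite ?mulr0 // !mulrBr Hv // Hw // subrr.
  - by move=> v r Hv u Iu z; rewrite mulrA -(mulrA u) Hv.
apply: (primeA _ _ (grg _ homx) (grg _ homy)).
- exact: nonzero_of_elt (memg x) nzx.
- exact: nonzero_of_elt (memg y) nzy.
apply/seteqP; split; last first.
  by move=> _ -> M [[M0]].
apply: smallest_sub => [|_ [u Iu [v Iv <-]]].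
  by split=> // a b -> ->; rewrite /= subrr.
by have := prod0 v Iv u Iu 1; rewrite mulr1.
Qed.

Section Essential.

Variables (G : zmodType) (R : pzRingType) (A : G -> set R).
Hypothesis gA : is_grading A.

Lemma essential_sub (S T : set R) : S `<=` T -> essential A S -> essential A T.
Proof. by move=> ST essS x hx nx; have [r [/ST]] := essS x hx nx; exists r. Qed.

Lemma essential_homogeneous (T : set R) x :
  component_closed A T -> essential A T -> homogeneous A x -> x != 0 ->
  exists r, [/\ homogeneous A r, T (x * r) & x * r != 0].
Proof.
move=> clT essT homx nx; have [r [Tr nr]] := essT x homx nx.
have [g ng] := component_neq0 gA nr; have Tg := clT _ g Tr.
case: homx => h _ Ax; move: ng Tg; rewrite (component_mull gA _ _ Ax).
by exists (component A r (g - h)); split=> //; apply: component_homogeneous.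
Qed.

Lemma graded_right_idealI (S T : set R) :
  graded_right_ideal A S -> graded_right_ideal A T -> graded_right_ideal A (S `&` T).
Proof.
move=> [[[S0 Ssub] Smul] Scl] [[[T0 Tsub] Tmul] Tcl]; split; first split; first split => //.
- by move=> x y [Sx Tx] [Sy Ty]; split; [apply: Ssub|apply: Tsub].
- by move=> x r [Sx Tx]; split; [apply: Smul|apply: Tmul].
- by move=> x g [Sx Tx]; split; [apply: Scl|apply: Tcl].
Qed.

Lemma essentialI (S T : set R) :
  graded_right_ideal A S -> graded_right_ideal A T ->
  essential A S -> essential A T -> essential A (S `&` T).
Proof.
move=> [[_ Smul] Scl] _ essS essT x homx nx.
have [r [homr Sr nr]] := essential_homogeneous Scl essS homx nx.
have [t [Tt nt]] := essT _ (homogeneousM gA homx homr) nr.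
by exists (r * t); rewrite mulrA; split=> //; split=> //; apply: Smul.
Qed.

Lemma preimage_graded_right_ideal (T : set R) r :
  homogeneous A r -> graded_right_ideal A T ->
  graded_right_ideal A [set v | T (r * v)].
Proof.
move=> [h _ Ar] [[[T0 Tsub] Tmul] Tcl]; split; first split; first split=> /=.
- by rewrite mulr0.
- by move=> x y; rewrite mulrBr; apply: Tsub.
- by move=> x s Tx /=; rewrite mulrA; apply: Tmul.
move=> x g /= /(Tcl _ (g + h)).
by rewrite (component_mull gA _ _ Ar) addrK.
Qed.

Lemma preimage_essential (T : set R) r :
  T 0 -> homogeneous A r -> essential A T -> essential A [set v | T (r * v)].
Proof.
move=> T0 homr essT x homx nx /=.
have [rx0|nrx] := eqVneq (r * x) 0; first by exists 1; rewrite mulr1 rx0.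
have [t [Tt nt]] := essT _ (homogeneousM gA homr homx) nrx.
exists t; rewrite mulrA; split=> //.
by apply: contraNneq nt; rewrite -mulrA => ->; rewrite mulr0.
Qed.

(** An arbitrary r is a finite sum of homogeneous elements, so this is a
    finite intersection of the preimages of T under them. *)
Lemma essential_conductor (T : set R) r :
  graded_right_ideal A T -> essential A T ->
  exists K, [/\ graded_right_ideal A K, essential A K & forall v, K v -> T (r * v)].
Proof.
move=> grT essT; have subT : add_subgroup T by case: grT => -[].
elim/(homogeneous_ind gA): r => [|r t [K [grK essK KT]] [L [grL essL LT]]|r homr].
- by exists T; split=> // v _; rewrite mul0r; apply: subgroup0.
- exists (K `&` L); split; [exact: graded_right_idealI|exact: essentialI|].
  by move=> v [Kv Lv]; rewrite mulrDl; apply: subgroupD => //; [apply: KT|apply: LT].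
- exists [set v | T (r * v)]; split=> //; first exact: preimage_graded_right_ideal.
  by apply: preimage_essential => //; apply: subgroup0.
Qed.

End Essential.

(** * Homogeneous regular elements *)

Section Goldie.

Variables (G : zmodType) (R : pzRingType) (A : G -> set R).
Hypotheses (gA : is_grading A) (primeA : gr_prime A) (goldieA : right_gr_goldie A).

Lemma one_neq0 : 1 != 0 :> R.
Proof.
apply/eqP => R0; case: primeA => nz _; apply: nz; apply/seteqP; split=> //= x _.
by rewrite -[x]mulr1 R0 mulr0.
Qed.

Lemma maximal_annihilator (P : R -> Prop) :
  (forall x, P x -> homogeneous A x) -> (exists x, P x) ->
  exists2 a, P a & forall b, P b -> (forall v, a * v = 0 -> b * v = 0) ->
    forall v, b * v = 0 -> a * v = 0.
Proof.
move=> homP exP; case: goldieA => _ accA.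
have Cann x : P x -> [set right_annihilator S | S in [set S : set R | S `<=` homogeneous A]]
    (right_annihilator [set x]).
  by move=> Px; exists [set x] => // _ ->; apply: homP.
have [a Pa maxa] := acc_maximal accA Cann exP.
exists a => // b Pb sub v bv0.
have /seteqP[+ _] : right_annihilator [set b] = right_annihilator [set a].
  by apply: maxa => // w /(_ a erefl) aw0 _ ->; apply: sub.
by move=> /(_ v); apply => // _ ->.
Qed.

(** The graded right singular ideal vanishes: among its nonzero homogeneous
    elements let a have maximal annihilator, and choose y with aya nonzero, so that
    aya has the same annihilator.  This is essential, so it contains some nonzero
    yar; then r annihilates aya, hence a, and yar = 0 after all. *)
Lemma annihilator_not_essential x :
  homogeneous A x -> x != 0 -> ~ essential A [set v | x * v = 0].
Proof.
move=> homx nzx essx.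
have [||a [homa nza essa] maxa] := @maximal_annihilator
    (fun x => [/\ homogeneous A x, x != 0 & essential A [set v | x * v = 0]]).
- by move=> ? [].
- by exists x.
have [y homy nzaya] := gr_prime_elements gA primeA homa homa nza nza.
have nzya : y * a != 0 by apply: contraNneq nzaya; rewrite -mulrA => ->; rewrite mulr0.
have sub v : a * v = 0 -> a * y * a * v = 0 by move=> av0; rewrite -mulrA av0 mulr0.
have [r [/= ayar /eqP]] := essa _ (homogeneousM gA homy homa) nzya.
apply; rewrite -mulrA (maxa (a * y * a)) ?mulr0 //; last by rewrite -ayar !mulrA.
split=> //; first by do 2![apply: homogeneousM => //].
exact: essential_sub essa.
Qed.

Definition killed_by (s : seq (R * R)) : set R :=
  [set v | forall p, p \in s -> p.1 * p.2 * v = 0].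

(** A ladder in I is a finite list, latest entry first, of pairs (a, y) such
    that left multiplication by ay is injective on aR and kills all the later
    entries.  The last clause implies that injectivity; it holds because the
    annihilator of a is chosen maximal among those of the nonzero homogeneous
    elements of I that the earlier entries kill.  It will be applied to other z
    than y. *)
Fixpoint ladder (I : set R) (s : seq (R * R)) : Prop :=
  if s is p :: t then
    [/\ ladder I t, I p.1 /\ killed_by t p.1, homogeneous A p.1 /\ homogeneous A p.2,
        p.1 * p.2 * p.1 != 0
      & forall z v, homogeneous A z -> p.1 * z * p.1 != 0 ->
          p.1 * z * p.1 * v = 0 -> p.1 * v = 0]
  else True.

Lemma ladder_entry I s p : ladder I s -> p \in s ->
  [/\ I p.1, homogeneous A p.1 /\ homogeneous A p.2, p.1 * p.2 * p.1 != 0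
    & forall z v, homogeneous A z -> p.1 * z * p.1 != 0 ->
        p.1 * z * p.1 * v = 0 -> p.1 * v = 0].
Proof.
elim: s => //= q s IHs [lads [Iq _] homq nzq maxq].
by rewrite inE => /predU1P[-> //|/IHs]; apply.
Qed.

Lemma killed_by_right_ideal s : right_ideal (killed_by s).
Proof.
split=> [|v r kv p ps]; last by rewrite mulrA kv ?mul0r.
by split=> [p _|v w kv kw p ps]; rewrite ?mulr0 // mulrBr kv // kw // subrr.
Qed.

Lemma killed_by_graded I s : ladder I s -> graded_right_ideal A (killed_by s).
Proof.
move=> lads; split=> [|v g kv p ps]; first exact: killed_by_right_ideal.
have [_ [hom1 hom2] _ _] := ladder_entry lads ps.
have [h _ Ap] := homogeneousM gA hom1 hom2.
have := component_mull gA v (g + h) Ap.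
by rewrite addrK kv // component0.
Qed.

Lemma ladder_extend I s : graded_right_ideal A I -> ladder I s ->
  (exists2 v, I v /\ killed_by s v & v != 0) -> exists p, ladder I (p :: s).
Proof.
move=> grI lads [v Jv nzv].
have [[_ mulJ] clJ] := graded_right_idealI grI (killed_by_graded lads).
have [||a [homa nza Ja] maxa] := @maximal_annihilator
    (fun a => [/\ homogeneous A a, a != 0 & (I `&` killed_by s) a]).
- by move=> x [].
- have [g ng] := component_neq0 gA nzv; exists (component A v g); split=> //.
    exact: component_homogeneous.
  exact: clJ.
have [y homy nzaya] := gr_prime_elements gA primeA homa homa nza nza.
exists (a, y); split=> //= z w homz nzaza; apply: maxa.
  split=> //; first by do 2![apply: homogeneousM => //].
  by rewrite -mulrA; apply: mulJ.
by move=> u au0; rewrite -mulrA au0 mulr0.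
Qed.

Lemma ladder_injective I p s v :
  ladder I (p :: s) -> killed_by (p :: s) (p.1 * v) -> p.1 * v = 0.
Proof.
move=> [_ _ [_ hom2] nzp maxp] /(_ p (mem_head _ _)).
by rewrite mulrA; apply: maxp.
Qed.

(** An infinite ladder would give an infinite direct sum of right ideals aR. *)
Lemma ladder_exhausts I : graded_right_ideal A I ->
  exists2 s, ladder I s & forall v, I v -> killed_by s v -> v = 0.
Proof.
move=> grI; apply: contrapT => no.
have ext s : ladder I s -> exists2 t, ladder I t & exists p, t = p :: s.
  move=> lads; have [|p ladp] := ladder_extend grI lads; last by exists (p :: s) => //; exists p.
  apply: contrapT => none; apply: no; exists s => // v Iv kv.
  by apply: contrapT => /eqP nz; apply: none; exists v.
have [u uP] := dependent_sequence (Logic.I : ladder I [::]) ext.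
have lad n : ladder I (u n) by case: (uP n).
have [p pP] := choice (fun n => proj2 (uP n)).
have incl i j : (i <= j)%N -> {subset u i <= u j}.
  elim: j => [|j IHj]; first by rewrite leqn0 => /eqP->.
  rewrite leq_eqVlt => /predU1P[-> //|/IHj sub x /sub].
  by rewrite pP inE orbC => ->.
have entry n : ladder I (p n :: u n) by rewrite -pP.
have [fudA _] := goldieA.
apply: (finite_uniform_dim_range gA fudA (a := fun n => (p n).1)) => [n|n|].
- by case: (entry n) => _ _ [].
- by case: (entry n) => _ _ _ + _; apply: contraNneq => ->; rewrite mulr0.
apply: (@independent_of_order _ _ leq _ (fun n => killed_by (u n.+1))).
- exact: leq_total.
- exact: leq_trans.
- by move=> i; case: (killed_by_right_ideal (u i.+1)).
- move=> i j leij neij _ [t _ <-]; apply: (killed_by_right_ideal _).2 => q qi.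
  case: (entry j) => _ [_ kj] _ _ _; apply: kj; apply: incl qi.
  by rewrite ltn_neqAle neij.
- by move=> i _ [t _ <-]; rewrite pP => /(ladder_injective (entry i)).
Qed.

Lemma ladder_independent I s w (v : R * R -> R) :
  ladder I s -> killed_by s w -> w + \sum_(p <- s) p.1 * v p = 0 ->
  w = 0 /\ forall p, p \in s -> p.1 * v p = 0.
Proof.
elim: s w => [|p s IHs] w lad; first by rewrite big_nil addr0 => _ ->.
case: (lad) => lads [Ip kp] _ _ _ kw; rewrite big_cons addrA => sum0.
have kws : killed_by s w by move=> q qs; apply: kw; rewrite inE qs orbT.
have [|wp0 tl0] := IHs (w + p.1 * v p) lads _ sum0.
  have [sub mul] := killed_by_right_ideal s.
  by apply: (subgroupD sub) => //; apply: mul.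
have p0 : p.1 * v p = 0.
  apply: ladder_injective lad _.
  have -> : p.1 * v p = - w by apply/eqP; rewrite -addr_eq0 addrC wp0.
  by apply: subgroupN kw; case: (killed_by_right_ideal (p :: s)).
split=> [|q]; first by rewrite -wp0 p0 addr0.
by rewrite inE => /predU1P[->|/tl0].
Qed.

(** Induction on the list: if W works for its tail, a nonzero bxW works for
    the list with b added in front. *)
Lemma common_multiple (s : seq R) :
  (forall b, b \in s -> homogeneous A b /\ b != 0) ->
  exists W, [/\ homogeneous A W, W != 0 & forall b, b \in s ->
    exists p q, [/\ homogeneous A p, homogeneous A q & W = p * b * q]].
Proof.
elim: s => [_|b s IHs homs].
  by exists 1; split=> //; [exact: homogeneous1 | exact: one_neq0].
have [|W [homW nzW WP]] := IHs.
  by move=> c cs; apply: homs; rewrite inE cs orbT.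
have [homb nzb] := homs b (mem_head _ _).
have [x homx nz] := gr_prime_elements gA primeA homb homW nzb nzW.
exists (b * x * W); split=> //; first by do 2![apply: homogeneousM => //].
move=> c; rewrite inE => /predU1P[->|/WP [p [q [homp homq ->]]]].
  exists 1, (x * W); rewrite mul1r mulrA; split=> //; first exact: homogeneous1.
  exact: homogeneousM.
exists (b * x * p), q; rewrite !mulrA; split=> //.
by do 2![apply: homogeneousM => //].
Qed.

(** Take a ladder exhausting I, with entries (a, y).  Homogeneous elements
    c of the form azay with aza nonzero have the annihilator of ay.  To add them
    up they should have the same degree: write one nonzero W as p(aya)q for every
    entry, choose x with WxW nonzero and put z = qxp.  Then aza is not 0
    because (aya)z(aya) is a factor of WxW, and as G is abelian the degree of
    azay, a cyclic permutation of the factors of Wx, is that of Wx.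
    What annihilates the sum of the c annihilates each of them, since
    the sum of the aR is direct, so it annihilates each ay; and the common
    annihilator of the ay meets the essential ideal I trivially. *)
Lemma essential_has_nonzero_divisor I :
  graded_right_ideal A I -> essential A I ->
  exists c, [/\ I c, homogeneous A c & forall v, c * v = 0 -> v = 0].
Proof.
move=> grI essI; have [s lad exh] := ladder_exhausts grI.
have [|W [homW nzW WP]] := @common_multiple [seq p.1 * p.2 * p.1 | p <- s].
  move=> _ /mapP[p /(ladder_entry lad)[_ [hom1 hom2] nz _] ->]; split=> //.
  by do 2![apply: homogeneousM => //].
have [x homx nzWxW] := gr_prime_elements gA primeA homW homW nzW nzW.
case: (homW) => g _ AW; case: (homx) => h _ Ax.
have /choice[z zP] : forall p, exists z, p \in s ->
    [/\ homogeneous A z, p.1 * z * p.1 != 0 & A (g + h) (p.1 * z * p.1 * p.2)].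
  move=> [a y]; have [ps|] := boolP ((a, y) \in s); last by exists 0.
  have [_ /= [homa homy] nz _] := ladder_entry lad ps.
  have [l [r [homl homr WE]]] := WP _ (map_f _ ps).
  move: WE => /= WE; exists (r * x * l) => _; split=> /=.
  - by do 2![apply: homogeneousM => //].
  - apply: contraNneq nzWxW => aza0.
    have -> : W * x * W = l * a * y * (a * (r * x * l) * a) * y * a * r.
      by rewrite WE !mulrA.
    by rewrite aza0 !(mulr0, mul0r).
  case: homa homy homl homr => al _ Aa [be _ Ay] [la _ Al] [ro _ Ar].
  have gE : g = la + (al + be + al) + ro.
    apply: (degree_uniq gA nzW AW); rewrite WE.
    by do ![apply: gradingM => //].
  have -> : g + h = al + (ro + h + la) + al + be.
    by rewrite gE !addrA [LHS](ACl (2*5*6*1*4*3)).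
  by do ![apply: gradingM => //].
have [[subI mulI] clI] := grI.
exists (\sum_(p <- s) p.1 * (z p * p.1 * p.2)); split.
- apply: subgroup_sum => // p /(ladder_entry lad)[Ip _ _ _].
  exact: mulI.
- exists (g + h) => //; apply: (subgroup_sum (grading_subgroup gA (g + h))) => p /zP[_ _].
  by rewrite !mulrA.
move=> v cv0.
have killv w : \sum_(p <- s) p.1 * (z p * p.1 * p.2) * w = 0 -> killed_by s w.
  move=> sum0 p ps.
  have [_ _ _ maxp] := ladder_entry lad ps; have [homz nzz _] := zP p ps.
  rewrite -mulrA; apply: (maxp (z p)) => //.
  have [||_ /(_ p ps)] := @ladder_independent I s 0 (fun p => z p * p.1 * p.2 * w) lad.
  - by apply: subgroup0; case: (killed_by_right_ideal s).
  - by rewrite add0r -[RHS]sum0; apply: eq_bigr => q _; rewrite !mulrA.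
  - by rewrite !mulrA.
have kv : killed_by s v by apply: killv; rewrite -mulr_suml.
have [[_ mulK] clK] := killed_by_graded lad.
apply: (components_eq0 gA) => k; apply: contrapT => /eqP nzk.
have [r [Ir]] := essI _ (component_homogeneous gA v k) nzk.
by move/eqP; apply; apply: exh => //; apply: mulK; apply: clK.
Qed.

(** If xR meets cR trivially then the right ideals xR, cxR, ccxR, and so on are
    independent. *)
Lemma nonzero_divisor_essential c :
  homogeneous A c -> (forall v, c * v = 0 -> v = 0) -> essential A (range ( *%R c)).
Proof.
move=> homc regc x homx nzx; apply: contrapT => no.
have meet0 r t : x * r = c * t -> x * r = 0.
  move=> eqx; apply: contrapT => /eqP nz; apply: no; exists r; split=> //.
  by exists t.
have regcn n v : c ^+ n * v = 0 -> v = 0.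
  by elim: n => [|n IHn]; rewrite ?mul1r // exprS -mulrA => /regc.
have [fudA _] := goldieA.
apply: (finite_uniform_dim_range gA fudA (a := fun n => c ^+ n * x)) => [n|n|].
- apply: homogeneousM => //; elim: n => [|n IHn]; first exact: homogeneous1.
  by rewrite exprS; apply: homogeneousM.
- by apply: contraNneq nzx => /regcn ->.
apply: (@independent_of_order _ _ leq _ (fun n => range ( *%R (c ^+ n.+1)))).
- exact: leq_total.
- exact: leq_trans.
- by move=> i; case: (range_mul_right_ideal (c ^+ i.+1)).
- move=> i j leij neij _ [t _ <-].
  have ltij : (i < j)%N by rewrite ltn_neqAle neij.
  by exists (c ^+ (j - i.+1) * x * t); rewrite // !mulrA -exprD subnKC.
- move=> i _ [t _ <-] [t' _] /eqP.
  rewrite -subr_eq0 exprSr -!mulrA -mulrBr => /eqP/regcn/eqP.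
  by rewrite subr_eq0 => /eqP/esym/meet0 ->; rewrite mulr0.
Qed.

(** If xc = 0 with x homogeneous, the annihilator of x contains the essential right
    ideal cR, so x = 0. *)
Lemma nonzero_divisor_regular c :
  homogeneous A c -> (forall v, c * v = 0 -> v = 0) -> homogeneous_regular A c.
Proof.
move=> homc regc; split=> //; first exact: mulrI0_lreg.
apply: mulIr0_rreg => x xc0; apply: (components_eq0 gA) => g.
apply: contrapT => /eqP nz.
apply: (annihilator_not_essential (component_homogeneous gA x g) nz).
apply: essential_sub (nonzero_divisor_essential homc regc) => _ [t _ <-] /=.
case: (homc) => h _ Ac; have := component_mulr gA x (g + h) Ac.
by rewrite addrK mulrA xc0 component0 // => <-; rewrite mul0r.
Qed.

Lemma essential_has_regular I :
  graded_right_ideal A I -> essential A I -> exists2 c, I c & homogeneous_regular A c.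
Proof.
move=> grI essI; have [c [Ic homc regc]] := essential_has_nonzero_divisor grI essI.
by exists c => //; apply: nonzero_divisor_regular.
Qed.

Lemma regular_denominators : right_denominator_set (homogeneous_regular A).
Proof.
split.
- by split; [exact: homogeneous1 | exact: lreg1 | exact: rreg1].
- move=> c d [homc lc rc] [homd ld rd].
  by split; [exact: homogeneousM | exact: lregM | exact: rregM].
- move=> r c [homc lc rc].
  have grc : graded_right_ideal A (range ( *%R c)).
    by split; [exact: range_mul_right_ideal | exact: range_mul_closed].
  have essc : essential A (range ( *%R c)).
    by apply: nonzero_divisor_essential => // v cv0; apply: lc; rewrite cv0 mulr0.
  have [K [grK essK Kc]] := essential_conductor gA r grc essc.
  have [d Kd regd] := essential_has_regular grK essK.
  by have [s _ eqs] := Kc d Kd; exists s, d.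
- by move=> r c Ec cr0; exists c => //; case: Ec => _ lc _; rewrite (lc r 0) ?mul0r ?mulr0.
Qed.

End Goldie.

(** * The ring of fractions as a ring of germs *)

Section Germs.

Variables (R : pzRingType) (E : set R).
Hypotheses (denE : right_denominator_set E).
Hypothesis regE : forall c, E c -> GRing.lreg c.
Hypothesis nzR : 1 != 0 :> R.

(** By the Ore condition the right ideals cR with c in E generate a filter, along
    which germs are taken. *)
Definition eventually (P : R -> Prop) : Prop := exists2 c, E c & forall v, P (c * v).

Lemma eventuallyT (P : R -> Prop) : (forall v, P v) -> eventually P.
Proof. by move=> PT; exists 1; [case: denE | move=> v; apply: PT]. Qed.

Lemma eventuallyW (P Q : R -> Prop) :
  (forall v, P v -> Q v) -> eventually P -> eventually Q.
Proof. by move=> PQ [c Ec cP]; exists c => // v; apply: PQ. Qed.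

Lemma eventuallyI (P Q : R -> Prop) :
  eventually P -> eventually Q -> eventually (fun v => P v /\ Q v).
Proof.
case: denE => _ EM ore _ [c Ec cP] [d Ed dQ].
have [s [u [Eu eqs]]] := ore d c Ec.
exists (d * u) => [|v]; first exact: EM.
by split; [rewrite eqs -mulrA | rewrite -mulrA].
Qed.

(** A fraction tc^-1 is the germ of the left multiplication cv |-> tv.  With
    functions defined everywhere, the ring operations are pointwise addition
    and composition, and most ring axioms hold on the nose. *)
Record germ := Germ {
  germ_fun :> R -> R;
  germ_linear : exists c t, E c /\ forall v, germ_fun (c * v) = t * v }.

HB.instance Definition _ := gen_eqMixin germ.
HB.instance Definition _ := gen_choiceMixin germ.

Lemma germ_pullback (f : germ) (P : R -> Prop) :
  eventually P -> eventually (fun v => P (f v)).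
Proof.
case: f => f /= [c [t [Ec ct]]] [d Ed dP].
case: denE => _ EM ore _.
have [s [u [Eu eqs]]] := ore t d Ed.
exists (c * u) => [|v]; first exact: EM.
by rewrite -mulrA ct mulrA eqs -mulrA.
Qed.

Lemma germ_additive (f : germ) :
  exists2 P : R -> Prop, eventually P & forall v w, P v -> P w -> f (v + w) = f v + f w.
Proof.
case: f => f /= [c [t [Ec ct]]].
exists (range ( *%R c)); first by exists c => // v; exists v.
by move=> _ _ [v _ <-] [w _ <-]; rewrite -mulrDr !ct mulrDr.
Qed.

Definition germ_eq : rel germ := fun f g => `[< eventually (fun v => f v = g v) >].

Lemma germ_eq_refl : reflexive germ_eq.
Proof. by move=> f; apply/asboolP; apply: eventuallyT. Qed.

Lemma germ_eq_sym : symmetric germ_eq.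
Proof. by move=> f g; apply/asboolP/asboolP; apply: eventuallyW. Qed.

Lemma germ_eq_trans : transitive germ_eq.
Proof.
move=> g f h /asboolP fg /asboolP gh; apply/asboolP.
by apply: eventuallyW (eventuallyI fg gh) => v [->].
Qed.

Canonical germ_equiv := EquivRel germ_eq germ_eq_refl germ_eq_sym germ_eq_trans.

Definition fractions := {eq_quot germ_equiv}.

HB.instance Definition _ := Choice.on fractions.
HB.instance Definition _ := EqQuotient.on fractions.

Lemma fractionsP (f g : germ) :
  \pi_fractions f = \pi_fractions g <-> eventually (fun v => f v = g v).
Proof.
by split=> [/eqmodP/asboolP|fg] //; apply/eqmodP/asboolP.
Qed.

Lemma scale_linear r : exists c t, E c /\ forall v, r * (c * v) = t * v.
Proof. by exists 1, r; split=> [|v]; [case: denE | rewrite mul1r]. Qed.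

Lemma add_linear (f g : germ) :
  exists c t, E c /\ forall v, f (c * v) + g (c * v) = t * v.
Proof.
case: f g => f [c [t [Ec ct]]] [g [d [u [Ed du]]]] /=.
case: denE => _ EM ore _; have [s [w [Ew eqs]]] := ore d c Ec.
exists (d * w), (t * s + u * w); split=> [|v]; first exact: EM.
by rewrite {1}eqs -!mulrA ct du mulrDl !mulrA.
Qed.

Lemma opp_linear (f : germ) : exists c t, E c /\ forall v, - f (c * v) = t * v.
Proof. by case: f => f [c [t [Ec ct]]]; exists c, (- t); split=> //= v; rewrite ct mulNr. Qed.

Lemma comp_linear (f g : germ) : exists c t, E c /\ forall v, f (g (c * v)) = t * v.
Proof.
case: f g => f [c [t [Ec ct]]] [g [d [u [Ed du]]]] /=.
case: denE => _ EM ore _; have [s [w [Ew eqs]]] := ore u c Ec.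
exists (d * w), (t * s); split=> [|v]; first exact: EM.
by rewrite -mulrA du mulrA eqs -mulrA ct mulrA.
Qed.

Definition germ_scale r := @Germ ( *%R r) (scale_linear r).
Definition germ_add (f g : germ) := @Germ (fun v => f v + g v) (add_linear f g).
Definition germ_opp (f : germ) := @Germ (fun v => - f v) (opp_linear f).
Definition germ_comp (f g : germ) := @Germ (fun v => f (g v)) (comp_linear f g).

Definition frac_of r : fractions := \pi_fractions (germ_scale r).
Definition frac_add := lift_op2 fractions germ_add.
Definition frac_opp := lift_op1 fractions germ_opp.
Definition frac_mul := lift_op2 fractions germ_comp.

Lemma pi_add : {morph \pi_fractions : f g / germ_add f g >-> frac_add f g}.
Proof.
move=> f g; unlock frac_add; apply/fractionsP.
have /fractionsP ff : \pi_fractions f = \pi_fractions (repr (\pi_fractions f)) by rewrite reprK.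
have /fractionsP gg : \pi_fractions g = \pi_fractions (repr (\pi_fractions g)) by rewrite reprK.
by apply: eventuallyW (eventuallyI ff gg) => v /= [-> ->].
Qed.

Lemma pi_opp : {morph \pi_fractions : f / germ_opp f >-> frac_opp f}.
Proof.
move=> f; unlock frac_opp; apply/fractionsP.
have /fractionsP : \pi_fractions f = \pi_fractions (repr (\pi_fractions f)) by rewrite reprK.
by apply: eventuallyW => v /= ->.
Qed.

Lemma pi_mul : {morph \pi_fractions : f g / germ_comp f g >-> frac_mul f g}.
Proof.
move=> f g; unlock frac_mul; apply/fractionsP.
have /fractionsP ff : \pi_fractions f = \pi_fractions (repr (\pi_fractions f)) by rewrite reprK.
have /fractionsP gg : \pi_fractions g = \pi_fractions (repr (\pi_fractions g)) by rewrite reprK.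
by apply: eventuallyW (eventuallyI (germ_pullback g ff) gg) => v /= [-> ->].
Qed.

Lemma frac_ind (P : fractions -> Prop) : (forall f, P (\pi_fractions f)) -> forall q, P q.
Proof. by move=> Ppi q; rewrite -[q]reprK. Qed.

Fact frac_addA : associative frac_add.
Proof.
elim/frac_ind=> f; elim/frac_ind=> g; elim/frac_ind=> h; rewrite -!pi_add.
by apply/fractionsP/eventuallyT => v /=; rewrite addrA.
Qed.

Fact frac_addC : commutative frac_add.
Proof.
elim/frac_ind=> f; elim/frac_ind=> g; rewrite -!pi_add.
by apply/fractionsP/eventuallyT => v /=; rewrite addrC.
Qed.

Fact frac_add0 : left_id (frac_of 0) frac_add.
Proof.
elim/frac_ind=> f; rewrite -!pi_add.
by apply/fractionsP/eventuallyT => v /=; rewrite mul0r add0r.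
Qed.

Fact frac_addN : left_inverse (frac_of 0) frac_opp frac_add.
Proof.
elim/frac_ind=> f; rewrite -pi_opp -pi_add.
by apply/fractionsP/eventuallyT => v /=; rewrite mul0r addNr.
Qed.

HB.instance Definition _ :=
  GRing.isZmodule.Build fractions frac_addA frac_addC frac_add0 frac_addN.

Fact frac_mulA : associative frac_mul.
Proof.
elim/frac_ind=> f; elim/frac_ind=> g; elim/frac_ind=> h; rewrite -!pi_mul.
exact/fractionsP/eventuallyT.
Qed.

Fact frac_mul1 : left_id (frac_of 1) frac_mul.
Proof.
elim/frac_ind=> f; rewrite -pi_mul.
by apply/fractionsP/eventuallyT => v /=; rewrite mul1r.
Qed.

Fact frac_mulr1 : right_id (frac_of 1) frac_mul.
Proof.
elim/frac_ind=> f; rewrite -pi_mul.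
by apply/fractionsP/eventuallyT => v /=; rewrite mul1r.
Qed.

Fact frac_mulDl : left_distributive frac_mul +%R.
Proof.
elim/frac_ind=> f; elim/frac_ind=> g; elim/frac_ind=> h.
rewrite -[_ + _]pi_add -!pi_mul -[RHS]pi_add.
exact/fractionsP/eventuallyT.
Qed.

Fact frac_mulDr : right_distributive frac_mul +%R.
Proof.
elim/frac_ind=> f; elim/frac_ind=> g; elim/frac_ind=> h.
rewrite -[_ + _]pi_add -!pi_mul -[RHS]pi_add; apply/fractionsP.
have [P evP addf] := germ_additive f.
have evPgh := eventuallyI (germ_pullback g evP) (germ_pullback h evP).
by apply: eventuallyW evPgh => v []; apply: addf.
Qed.

Fact frac_one_neq0 : frac_of 1 != 0.
Proof.
apply/eqP => /fractionsP[c Ec /(_ 1)] /=; rewrite mul0r mul1r mulr1 => c0.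
by case/eqP: nzR; apply: (regE Ec); rewrite c0 !mul0r.
Qed.

HB.instance Definition _ := GRing.Zmodule_isNzRing.Build fractions
  frac_mulA frac_mul1 frac_mulr1 frac_mulDl frac_mulDr frac_one_neq0.

Let is_inverse (q p : fractions) := p * q = 1 /\ q * p = 1.

Definition frac_unit : pred fractions := fun q => `[< exists p, is_inverse q p >].

Definition frac_inv (q : fractions) : fractions := xget q (is_inverse q).

Fact frac_mulVr : {in frac_unit, left_inverse 1 frac_inv *%R}.
Proof. by move=> q /asboolP/(xgetPex q)[]. Qed.

Fact frac_divrr : {in frac_unit, right_inverse 1 frac_inv *%R}.
Proof. by move=> q /asboolP/(xgetPex q)[]. Qed.

Fact frac_unitP q p : p * q = 1 /\ q * p = 1 -> frac_unit q.
Proof. by move=> qp; apply/asboolP; exists p. Qed.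

Fact frac_inv_out : {in [predC frac_unit], frac_inv =1 id}.
Proof.
move=> q; rewrite inE => /asboolP nounit; rewrite /frac_inv.
by case: xgetP => // p _ qp; case: nounit; exists p.
Qed.

HB.instance Definition _ := GRing.NzRing_hasMulInverse.Build fractions
  frac_mulVr frac_divrr frac_unitP frac_inv_out.

Fact frac_of_zmod_morphism : zmod_morphism frac_of.
Proof.
move=> r s; rewrite -[- frac_of s]pi_opp -[RHS]pi_add.
by apply/fractionsP/eventuallyT => v /=; rewrite mulrBl.
Qed.

Fact frac_of_monoid_morphism : monoid_morphism frac_of.
Proof.
split=> // r s; rewrite -[RHS]pi_mul.
by apply/fractionsP/eventuallyT => v /=; rewrite mulrA.
Qed.

HB.instance Definition _ :=
  GRing.isZmodMorphism.Build R fractions frac_of frac_of_zmod_morphism.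
HB.instance Definition _ :=
  GRing.isMonoidMorphism.Build R fractions frac_of frac_of_monoid_morphism.

Lemma inverse_linear c : E c ->
  exists d t, E d /\ forall v, xget 0 [set w | c * w = d * v] = t * v.
Proof.
move=> Ec; exists c, 1; split=> // v; apply: (regE Ec).
by rewrite mul1r; apply: (@xgetPex _ 0 [set w | c * w = c * v]); exists v.
Qed.

Lemma frac_of_unit c : E c -> frac_of c \is a GRing.unit.
Proof.
move=> Ec; apply/unitrP; pose ginv := @Germ (fun v => xget 0 [set w | c * w = v]) (inverse_linear Ec).
exists (\pi_fractions ginv).
rewrite -[_ * frac_of c]pi_mul -[frac_of c * _]pi_mul; split; apply/fractionsP.
  apply: eventuallyT => v /=; rewrite mul1r; apply: (regE Ec).
  by apply: (@xgetPex _ 0 [set w | c * w = c * v]); exists v.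
exists c => // v /=; rewrite mul1r.
by apply: (@xgetPex _ 0 [set w | c * w = c * v]); exists v.
Qed.

Lemma fractions_exist :
  exists (Q : unitRingType) (phi : {rmorphism R -> Q}), right_ring_of_fractions E phi.
Proof.
exists fractions, frac_of; split; first exact: frac_of_unit.
  elim/frac_ind=> f; have [c [t [Ec ct]]] := germ_linear f; exists t, c; split=> //.
  apply: (mulIr (frac_of_unit Ec)); rewrite divrK ?frac_of_unit // -[LHS]pi_mul.
  by apply/fractionsP/eventuallyT.
move=> r; split=> [|[c Ec rc0]].
  rewrite -(rmorph0 frac_of) => /fractionsP[c Ec rc0]; exists c => //.
  by have /= := rc0 1; rewrite mul0r mulr1.
rewrite -(rmorph0 frac_of); apply/fractionsP; exists c => // v /=.
by rewrite mul0r mulrA rc0 mul0r.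
Qed.

End Germs.

(** * Graded semisimple rings *)

(** In a direct sum of finitely many gr-simple right modules each submodule has
    a complement in any larger one, so it is not essential there; the arguments
    below use semisimplicity in this form. *)
Definition gr_semisimple (G : zmodType) (Q : pzRingType) (B : G -> set Q) : Prop :=
  no_infinite_direct_sum B /\
  forall K I, graded_right_ideal B K -> graded_right_ideal B I -> K `<=` I -> K <> I ->
    exists y, [/\ homogeneous B y, I y, y != 0 & forall q, K (y * q) -> y * q = 0].

Section Semisimple.

Variables (G : zmodType) (Q : pzRingType) (B : G -> set Q).
Hypotheses (gB : is_grading B) (ssB : gr_semisimple B).

(** Between two terms of a strict chain there is some yQ, and these are
    independent: in a descending chain each meets the next term trivially, in an
    ascending one the previous term. *)
Lemma right_dcc : dcc (graded_right_ideal B).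
Proof.
move=> C grC dec; have [fud ss] := ssB.
apply: chain_stabilizes => u u_inc; apply: contrapT => no.
have mono : forall i j, (i <= j)%N -> C (u j) `<=` C (u i).
  by apply: descending_chain => k; apply/(descending_chain dec)/ltnW.
have /choice[y yP] k : exists y, [/\ homogeneous B y, C (u k) y, y != 0 &
    forall q, C (u k.+1) (y * q) -> y * q = 0].
  apply: ss => //; first exact: mono.
  by move=> eqC; apply: no; exists k.
apply: (fud y) => [n|n|]; try by case: (yP n).
apply: (@independent_of_order _ _ leq _ (fun k => C (u k.+1))).
- exact: leq_total.
- exact: leq_trans.
- by move=> i; case: (grC (u i.+1)) => [[]].
- move=> i j leij neij _ [t _ <-].
  apply: (mono i.+1 j); first by rewrite ltn_neqAle neij.
  by case: (grC (u j)) => -[_ mulC] _; apply: mulC; case: (yP j).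
- by move=> i _ [t _ <-]; case: (yP i) => _ _ _; apply.
Qed.

Lemma right_acc : acc (graded_right_ideal B).
Proof.
move=> C grC inc; have [fud ss] := ssB.
apply: chain_stabilizes => u u_inc; apply: contrapT => no.
have mono : forall i j, (i <= j)%N -> C (u i) `<=` C (u j).
  by apply: ascending_chain => k; apply/(ascending_chain inc)/ltnW.
have /choice[y yP] k : exists y, [/\ homogeneous B y, C (u k.+1) y, y != 0 &
    forall q, C (u k) (y * q) -> y * q = 0].
  apply: ss => //; first exact: mono.
  by move=> eqC; apply: no; exists k.
apply: (fud y) => [n|n|]; try by case: (yP n).
apply: (@independent_of_order _ _ geq _ (fun k => C (u k))).
- by move=> i j; apply: leq_total.
- by move=> i j k leij leki; apply: leq_trans leki leij.
- by move=> i; case: (grC (u i)) => [[]].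
- move=> i j leji neij _ [t _ <-].
  apply: (mono j.+1 i); first by rewrite ltn_neqAle eq_sym neij.
  by case: (grC (u j.+1)) => -[_ mulC] _; apply: mulC; case: (yP j).
- by move=> i _ [t _ <-]; case: (yP i) => _ _ _; apply.
Qed.

Definition add_multiples (K : set Q) (x : Q) : set Q :=
  [set v | exists k t, K k /\ v = k + x * t].

Lemma add_multiples_graded K x :
  graded_right_ideal B K -> homogeneous B x -> graded_right_ideal B (add_multiples K x).
Proof.
move=> [[subK mulK] clK] [h _ Bx]; split; first split; first split.
- by exists 0, 0; rewrite mulr0 addr0; split=> //; apply: subgroup0.
- move=> _ _ [k [t [Kk ->]]] [k' [t' [Kk' ->]]]; exists (k - k'), (t - t').
  by split; [apply: subgroupB | rewrite mulrBr opprD addrACA].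
- move=> _ r [k [t [Kk ->]]]; exists (k * r), (t * r).
  by split; [apply: mulK | rewrite mulrDl mulrA].
move=> _ g [k [t [Kk ->]]]; exists (component B k g), (component B t (g - h)).
by split; [apply: clK | rewrite componentD // (component_mull gB _ _ Bx)].
Qed.

(** If K is maximal among the graded right ideals that meet xQ trivially, then
    K + xQ is essential, hence is Q.  Write 1 = k + xt; then kx = x - xtx is in
    both K and xQ, so it vanishes. *)
Lemma von_neumann_regular h x : B h x -> exists2 z, B (- h) z & x * z * x = x.
Proof.
move=> Bx; have homx : homogeneous B x by exists h.
have [|| K [grK Kx] maxK] := @acc_maximal _ _ id _
    (fun K => graded_right_ideal B K /\ forall q, K (x * q) -> x * q = 0) right_acc.
- by move=> K [].
- exists [set 0]; split=> //; split; first split; first split=> //.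
  + by move=> _ _ -> ->; rewrite /= subrr.
  + by move=> _ r -> /=; rewrite mul0r.
  + by move=> _ g -> /=; rewrite component0.
have gr_all : graded_right_ideal B [set: Q] by [].
have [[subK mulK] clK] := grK.
have K'T : add_multiples K x = [set: Q].
  apply: contrapT => notT; have [_ ss] := ssB.
  have [//|y [homy _ nzy y0]] := ss _ _ (add_multiples_graded grK homx) gr_all _ notT.
  have eqK : add_multiples K y = K.
    apply: maxK; last by move=> k Kk; exists k, 0; rewrite mulr0 addr0.
    split=> [|q [k [t [Kk xq]]]]; first exact: add_multiples_graded.
    apply: Kx; rewrite xq y0 ?addr0 //; exists (- k), q.
    by split; [apply: subgroupN | rewrite xq addKr].
  move/negP: nzy; apply; apply/eqP; rewrite -[y]mulr1; apply: y0.
  exists y, 0; rewrite mulr0 addr0 mulr1; split=> //; rewrite -eqK.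
  by exists 0, 1; rewrite add0r mulr1; split=> //; apply: subgroup0.
have [k [t [Kk one]]] : add_multiples K x 1 by rewrite K'T.
have kxE : k * x = x * (1 - t * x).
  by rewrite mulrBr mulr1 mulrA -{2}[x]mul1r one mulrDl addrK.
have /eqP : x * (1 - t * x) = 0 by apply: Kx; rewrite -kxE; apply: mulK.
rewrite mulrBr mulr1 subr_eq0 => /eqP xtx.
exists (component B t (- h)); first exact: component_in.
have := component_hom gB h Bx; rewrite eqxx => {3}<-.
by rewrite {3}xtx mulrA (component_mulr gB _ _ Bx) (component_mull gB _ _ Bx) subrr sub0r.
Qed.

(** Let e be an idempotent in L, of degree 0, with eQ maximal.  If a homogeneous x
    in L differs from xe, write y = x - xe = yzy; then f = zy is an idempotent in L
    with fe = 0, and e + f - ef is one that generates a larger right ideal. *)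
Lemma graded_left_ideal_idempotent L : left_ideal L -> component_closed B L ->
  exists e, [/\ B 0 e, L e & forall x, L x -> x * e = x].
Proof.
move=> [subL mulL] clL.
have [|| e [B0e Le ee] maxe] := @acc_maximal _ _ (fun e => range ( *%R e)) _
    (fun e => [/\ B 0 e, L e & e * e = e]) right_acc.
- move=> e [B0e _ _]; split; first exact: range_mul_right_ideal.
  by apply: range_mul_closed => //; exists 0.
- exists 0; rewrite mulr0; split=> //; first exact: subgroup0 (grading_subgroup gB 0).
  exact: subgroup0.
exists e; split=> //.
have hom_case h x : B h x -> L x -> x - x * e = 0.
  move=> Bx Lx; set y := x - x * e.
  have Ly : L y by apply: subgroupB => //; apply: mulL.
  have ye : y * e = 0 by rewrite mulrBl -mulrA ee subrr.
  have By : B h y.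
    apply: subgroupB => //; first exact: grading_subgroup.
    by rewrite -[h]addr0; apply: gradingM.
  have [z Bz yzy] := von_neumann_regular By.
  have [f fE] : exists f, f = z * y by exists (z * y).
  have ff : f * f = f by rewrite fE -mulrA (mulrA y) yzy.
  have fe : f * e = 0 by rewrite fE -mulrA ye mulr0.
  have B0f : B 0 f by rewrite fE -(addNr h); apply: gradingM.
  have Lf : L f by rewrite fE; apply: mulL.
  pose e' := e + f - e * f.
  have e'e : e' * e = e by rewrite mulrBl mulrDl ee -mulrA fe mulr0 addr0 subr0.
  have ee' : e * e' = e by rewrite mulrBr mulrDr ee mulrA ee addrK.
  have fe' : f * e' = f by rewrite mulrBr mulrDr fe mulrA fe mul0r add0r subr0 ff.
  have Pe' : [/\ B 0 e', L e' & e' * e' = e'].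
    split.
    - have subB := grading_subgroup gB 0.
      apply: (subgroupB subB); first exact: (subgroupD subB).
      by rewrite -[0](addr0 0); apply: gradingM.
    - by apply: (subgroupB subL); [apply: subgroupD | apply: mulL].
    - by rewrite mulrBl mulrDl ee' fe' -mulrA fe'.
  have /seteqP[sub _] : range ( *%R e') = range ( *%R e).
    by apply: maxe => // _ [t _ <-]; exists (e * t); rewrite // mulrA e'e.
  have [|t _ e'E] := sub e'; first by exists 1; rewrite ?mulr1.
  have e'_e : e' = e by rewrite -ee' -e'E mulrA ee.
  have f0 : f = 0 by rewrite -ff -{1}fe' e'_e fe mul0r.
  by rewrite -yzy -mulrA -fE f0 mulr0.
move=> x Lx; apply/esym/eqP; rewrite -subr_eq0; apply/eqP.
apply: (components_eq0 gB) => g; rewrite componentB //.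
rewrite (component_mulr gB _ _ B0e) subr0; apply: hom_case (clL _ _ Lx).
exact: component_in.
Qed.

(** Left ideals Qe are recovered from the right ideals that annihilate them, so
    the descending condition on the left is the ascending one on the right. *)
Lemma left_dcc (C : nat -> set Q) :
  (forall n, left_ideal (C n) /\ component_closed B (C n)) ->
  (forall n, C n.+1 `<=` C n) -> exists N, forall n, (N <= n)%N -> C n = C N.
Proof.
move=> grC dec.
have /choice[e eP] n : exists e, [/\ B 0 e, C n e & forall x, C n x -> x * e = x].
  by case: (grC n) => lC clC; apply: graded_left_ideal_idempotent.
have [||N NP] := right_acc (C := fun n => [set v | e n * v = 0]).
- move=> n; case: (eP n) => B0e _ _; split; first split; first split=> /=.
  + by rewrite mulr0.
  + by move=> v w ev ew; rewrite mulrBr ev ew subrr.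
  + by move=> v r ev /=; rewrite mulrA ev mul0r.
  move=> v g /= ev; have := component_mull gB v g B0e.
  by rewrite ev component0 // subr0.
- move=> n v /= ev; case: (eP n) (eP n.+1) => _ _ en [_ Cen _].
  by rewrite -(en _ (dec n _ Cen)) -mulrA ev mulr0.
exists N => n leNn; apply/seteqP; split; first exact: descending_chain dec _ _ leNn.
move=> x CNx; case: (eP N) (eP n) => _ CNe eN [_ Cne en].
have [[subC mulC] _] := grC n.
have /seteqP[+ _] := NP n leNn; move=> /(_ (1 - e n)) /=.
rewrite mulrBr mulr1 (en _ Cne) subrr => /(_ erefl) /eqP.
rewrite mulrBr mulr1 subr_eq0 => /eqP eNn.
by rewrite -(eN x CNx) eNn mulrA; apply: mulC.
Qed.

Lemma semisimple_artinian : gr_artinian B.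
Proof.
split=> C grC dec.
  apply: right_dcc dec => n; split; first by case: (grC n).
  exact: graded_right_closed (grC n).
apply: left_dcc dec => n; split; first by case: (grC n).
exact: graded_left_closed (grC n).
Qed.

End Semisimple.

(** * The grading of the ring of fractions *)

Definition fraction_grading (G : zmodType) (R Q : pzRingType) (A : G -> set R)
    (phi : R -> Q) (g : G) : set Q :=
  [set q | exists h c t,
    [/\ homogeneous_regular A c, A h c, A (g + h) t & q * phi c = phi t]].

Section FractionGrading.

Variables (G : zmodType) (R : pzRingType) (A : G -> set R).
Hypotheses (gA : is_grading A) (denA : right_denominator_set (homogeneous_regular A)).
Variables (Q : unitRingType) (phi : {rmorphism R -> Q}).
Hypothesis fracQ : right_ring_of_fractions (homogeneous_regular A) phi.

Local Notation E := (homogeneous_regular A).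
Local Notation B := (fraction_grading A phi).

Let A0 g : A g 0. Proof. exact: subgroup0 (grading_subgroup gA g). Qed.

Lemma regularM c d : E c -> E d -> E (c * d).
Proof. by case: denA => _ EM _ _; apply: EM. Qed.

Lemma phi_unit c : E c -> phi c \is a GRing.unit.
Proof. by case: fracQ => + _ _; apply. Qed.

Lemma phi_inj : injective phi.
Proof.
move=> x y eqxy; apply/eqP; rewrite -subr_eq0; apply/eqP.
have [_ _ ker] := fracQ; have [|c [_ _ rc] xyc] := (ker (x - y)).1.
  by rewrite rmorphB eqxy subrr.
by apply: rc; rewrite /= xyc mul0r.
Qed.

Lemma clear_denominator q : exists h c t, [/\ E c, A h c & q * phi c = phi t].
Proof.
have [_ surj _] := fracQ; have [t [c [Ec ->]]] := surj q.
case: (Ec) => -[h _ Ac] _ _; exists h, c, t; split=> //.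
by rewrite divrK // phi_unit.
Qed.

(** The degree of a fraction can be read off from any of its denominators: two
    denominators have a common right multiple, and regular elements cancel. *)
Lemma fraction_grading_any g q h c t :
  B g q -> E c -> A h c -> q * phi c = phi t -> A (g + h) t.
Proof.
move=> [k [d [u [Ed Ad Au qd]]]] Ec Ac qc.
have [_ _ ore _] := denA; have [s [e [Ee ce_ds]]] := ore c d Ed.
case: (Ee) => -[l _ Ae] _ rege; case: (Ed) => _ regd _.
have As : A (h + l - k) s.
  by apply: grading_cancell Ad regd _ => //; rewrite subrK -ce_ds; apply: gradingM.
apply: grading_cancelr Ae rege _ => //.
have -> : t * e = u * s.
  by apply: phi_inj; rewrite !rmorphM -qc -qd -!mulrA -!rmorphM ce_ds.
have -> : g + h + l = g + k + (h + l - k) by rewrite [RHS]addrA (addrAC g k) addrK addrA.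
exact: gradingM.
Qed.

Lemma common_denominator (s : seq Q) :
  exists h c, [/\ E c, A h c & forall q, q \in s -> exists t, q * phi c = phi t].
Proof.
elim: s => [|q s [h [c [Ec Ac cP]]]].
  by case: denA => E1 _ _ _; exists 0, 1; split=> //; apply: grading1.
have [k [d [u [Ed Ad qd]]]] := clear_denominator q.
have [_ _ ore _] := denA; have [v [e [Ee ce_dv]]] := ore c d Ed.
case: (Ee) => -[l _ Ae] _ _.
exists (h + l), (c * e); split; [exact: regularM | exact: gradingM |] => p.
rewrite inE => /predU1P[->|/cP[t pc]].
  by exists (u * v); rewrite ce_dv rmorphM mulrA qd rmorphM.
by exists (t * e); rewrite rmorphM mulrA pc rmorphM.
Qed.

Lemma fraction_grading_extends : extends_grading phi A B.
Proof.
have E1 : E 1 by case: denA.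
move=> g; apply/seteqP; split=> r.
  move=> /= Br; rewrite -[g]addr0; apply: fraction_grading_any Br E1 _ _ => //.
    exact: grading1.
  by rewrite rmorph1 mulr1.
move=> Ar; exists 0, 1, r; split=> //; first exact: grading1.
  by rewrite addr0.
by rewrite rmorph1 mulr1.
Qed.

Lemma phi_graded g r : A g r -> B g (phi r).
Proof. by rewrite -(fraction_grading_extends g). Qed.

Lemma fraction_grading_subgroup g : add_subgroup (B g).
Proof.
split=> [|q p Bq Bp]; first by rewrite -(rmorph0 phi); apply: phi_graded.
have [h [c [Ec Ac cP]]] := common_denominator [:: q; p].
have [|t qc] := cP q; first by rewrite inE eqxx.
have [|u pc] := cP p; first by rewrite !inE eqxx orbT.
exists h, c, (t - u); split=> //; last by rewrite mulrBl qc pc rmorphB.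
apply: subgroupB; first exact: grading_subgroup.
  exact: fraction_grading_any Bq Ec Ac qc.
exact: fraction_grading_any Bp Ec Ac pc.
Qed.

Lemma fraction_grading_independent : independent B.
Proof.
move=> s f us Bf sum0.
have [h [c [Ec Ac cP]]] := common_denominator (map f s).
have /choice[t tP] i : exists t, i \in s -> f i * phi c = phi t.
  have [is_|] := boolP (i \in s); last by exists 0.
  by have [t tE] := cP _ (map_f f is_); exists t.
have [_ indA _ _] := gA.
have t0 j : j \in map (+%R^~ h) s -> t (j - h) = 0.
  apply: (indA _ (fun j => t (j - h))); first by rewrite map_inj_uniq //; apply: addIr.
    move=> _ /mapP[k ks ->]; rewrite addrK.
    exact: fraction_grading_any (Bf k ks) Ec Ac (tP k ks).
  rewrite big_map; apply: phi_inj; rewrite rmorph0 rmorph_sum /=.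
  transitivity ((\sum_(i <- s) f i) * phi c); last by rewrite sum0 mul0r.
  rewrite mulr_suml [RHS]big_seq [LHS]big_seq; apply: eq_bigr => k /tP ->.
  by rewrite addrK.
move=> i is_; apply: (mulIr (phi_unit Ec)); rewrite mul0r tP //.
by have := t0 _ (map_f (+%R^~ h) is_); rewrite addrK => ->; rewrite rmorph0.
Qed.

Lemma fraction_grading_spanning : spanning B.
Proof.
move=> q; have [h [c [t [Ec Ac qc]]]] := clear_denominator q.
have [AF [s [us _ ts]]] := componentP gA t.
exists (map (+%R^~ (- h)) s), (fun j => phi (component A t (j + h)) / phi c); split.
- by rewrite map_inj_uniq //; apply: addIr.
- move=> _ /mapP[k _ ->]; rewrite subrK; exists h, c, (component A t k); split=> //.
    by rewrite subrK.
  by rewrite divrK // phi_unit.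
apply: (mulIr (phi_unit Ec)).
rewrite qc big_map mulr_suml {1}ts rmorph_sum; apply: eq_bigr => k _ /=.
by rewrite divrK ?phi_unit // subrK.
Qed.

Lemma fraction_gradingM g g' q q' : B g q -> B g' q' -> B (g + g') (q * q').
Proof.
move=> [k [d [u [Ed Ad Au qd]]]] [h [c [t [Ec Ac At qc]]]].
have [_ _ ore _] := denA; have [s [e [Ee te_ds]]] := ore t d Ed.
case: (Ee) => -[l _ Ae] _ _; case: (Ed) => _ regd _.
have As : A (g' + h + l - k) s.
  by apply: grading_cancell Ad regd _ => //; rewrite subrK -te_ds; apply: gradingM.
exists (h + l), (c * e), (u * s); split; [exact: regularM | exact: gradingM | |].
  have -> : g + g' + (h + l) = g + k + (g' + h + l - k).
    by rewrite [RHS]addrA (addrAC g k) addrK !addrA.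
  exact: gradingM.
by rewrite !rmorphM -mulrA (mulrA q') qc -[phi t * phi e]rmorphM te_ds rmorphM mulrA qd.
Qed.

Lemma fraction_grading_is_grading : is_grading B.
Proof.
split.
- exact: fraction_grading_subgroup.
- exact: fraction_grading_independent.
- exact: fraction_grading_spanning.
- exact: fraction_gradingM.
Qed.

(** In any grading extending that of R the elements phi(t)/phi(c) have their
    expected degrees.  So one family of components contains the other, and two
    direct decompositions that are so related coincide. *)
Lemma fraction_grading_unique (B' : G -> set Q) :
  is_grading B' -> extends_grading phi A B' -> B' = B.
Proof.
move=> gB' extB'.
have BB' g : B g `<=` B' g.
  move=> q [h [c [t [Ec Ac At qc]]]].
  have B'c : B' h (phi c) by have := extB' h; rewrite predeqE => /(_ c)[_]; apply.
  apply: grading_cancelr B'c (mulIr (phi_unit Ec)) _ => //; rewrite qc.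
  by have := extB' (g + h); rewrite predeqE => /(_ t)[_]; apply.
apply/funext => g; apply/seteqP; split=> [q B'q|]; last exact: BB'.
have [Bcomp supp] := componentP fraction_grading_is_grading q.
have B'comp : decomposition B' q (component B q).
  by split=> // k; apply: BB'.
have := component_hom gB' g B'q; rewrite eqxx (componentE gB' B'comp) => <-.
exact: Bcomp.
Qed.

Lemma phi_component r g : component B (phi r) g = phi (component A r g).
Proof.
rewrite (@componentE _ _ _ fraction_grading_is_grading _ (fun g => phi (component A r g))) //.
have [Acomp [s [us s0 rs]]] := componentP gA r.
split=> [k|]; first exact: phi_graded.
exists s; split=> // [k /s0 ->|]; first by rewrite rmorph0.
by rewrite {1}rs rmorph_sum.
Qed.

Lemma homogeneous_fraction q : homogeneous B q ->
  exists c t, [/\ E c, homogeneous A t & q * phi c = phi t].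
Proof.
move=> [g _ [h [c [t [Ec _ At qc]]]]].
by exists c, t; split=> //; exists (g + h).
Qed.

Lemma phi_homogeneous r : homogeneous A r -> homogeneous B (phi r).
Proof. by move=> [g _ Ar]; exists g => //; apply: phi_graded. Qed.

Lemma phi_neq0 r : (phi r != 0) = (r != 0).
Proof. by rewrite -(rmorph0 phi) (inj_eq phi_inj). Qed.

Lemma fraction_no_infinite_direct_sum :
  no_infinite_direct_sum A -> no_infinite_direct_sum B.
Proof.
move=> fudA a homa nza indB.
have /choice[r rP] n : exists r, homogeneous A r /\ exists2 c, E c & a n * phi c = phi r.
  by have [c [t [Ec homt ac]]] := homogeneous_fraction (homa n); exists t; split=> //; exists c.
apply: (fudA r) => [n|n|s f us rf sum0 i is_]; first by case: (rP n).
  case: (rP n) => _ [c Ec ac]; rewrite -phi_neq0 -ac.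
  apply: contraNneq (nza n) => ac0; apply/eqP.
  by apply: (mulIr (phi_unit Ec)); rewrite mul0r.
apply: phi_inj; rewrite rmorph0; apply: (indB s (phi \o f)) => //= [j js|].
  case: (rP j) => _ [c Ec ac]; case: (rf j js) => t _ <-.
  by exists (phi c * phi t); rewrite // mulrA ac rmorphM.
by rewrite -rmorph_sum sum0 rmorph0.
Qed.

(** If a homogeneous x is in I but not in K, the graded right ideal of all v in R with xv in K
    contains no unit of Q, so it is not essential: some vR meets it trivially, and
    then xvQ meets K trivially. *)
Lemma fraction_semisimple :
  gr_prime A -> right_gr_goldie A -> gr_semisimple B.
Proof.
move=> primeA goldieA; have gB := fraction_grading_is_grading.
split=> [|K I [[subK mulK] clK] [[subI mulI] clI] KI neKI].
  apply: fraction_no_infinite_direct_sum; apply: finite_uniform_dim_range => //.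
  by case: goldieA.
have [x [homx Ix nKx]] : exists x, [/\ homogeneous B x, I x & ~ K x].
  apply: contrapT => no; apply: neKI; apply/seteqP; split=> // x Ix.
  apply: (of_components gB subK) => g; apply: contrapT => nK.
  apply: no; exists (component B x g); split=> //; last exact: clI.
  exact: component_homogeneous.
pose T := [set v | K (x * phi v)].
have clT : component_closed A T.
  case: homx => h _ Bx v g /= /(clK _ (g + h)).
  by rewrite (component_mull gB _ _ Bx) addrK phi_component.
have grT : graded_right_ideal A T.
  split=> //; split; first split.
  - by rewrite /T /= rmorph0 mulr0; apply: subgroup0.
  - by move=> v w; rewrite /T /= rmorphB mulrBr; apply: subgroupB.
  - by move=> v r Tv; rewrite /T /= rmorphM mulrA; apply: mulK.
have : ~ essential A T.
  move=> essT; have [c Kc Ec] := essential_has_regular gA primeA goldieA grT essT.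
  by apply: nKx; rewrite -[x](mulrK (phi_unit Ec)); apply: mulK.
move=> /existsNP[v /not_implyP[homv /not_implyP[nzv Tv]]].
have vT r : T (v * r) -> v * r = 0.
  by move=> Tr; apply: contrapT => /eqP nz; apply: Tv; exists r.
exists (x * phi v); split.
- by apply: homogeneousM => //; apply: phi_homogeneous.
- exact: mulI.
- apply: contraNneq nzv => xv0; rewrite -[v]mulr1; apply/eqP/vT.
  by rewrite /T /= mulr1 xv0; apply: subgroup0.
- move=> q; have [_ [c [t [Ec _ qc]]]] := clear_denominator q.
  have -> : q = phi t / phi c by rewrite -qc mulrK // phi_unit.
  move=> Kq; rewrite -mulrA (mulrA (phi v)) -rmorphM vT ?rmorph0 ?mul0r ?mulr0 //.
  rewrite /T /= rmorphM mulrA.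
  by have := mulK _ (phi c) Kq; rewrite !mulrA divrK // phi_unit.
Qed.

(** A nonzero graded ideal of Q meets R in a nonzero two-sided ideal.  In
    a gr-prime ring this is essential as a right ideal, so it contains a
    homogeneous regular element, which is a unit of Q. *)
Lemma fraction_simple : gr_prime A -> right_gr_goldie A -> gr_simple B.
Proof.
move=> primeA goldieA; have gB := fraction_grading_is_grading; split.
  move=> Q0; have := oner_neq0 Q.
  have : [set: Q] 1 by [].
  by rewrite Q0 => ->; rewrite eqxx.
move=> I grI; have clI := graded_two_sided_closed gB grI.
case: grI => -[[subI mulI] [_ lmulI]] _.
have [->|nzI] := EM (I = [set 0]); [by left | right].
have [x Ix nzx] := nonzero_elt subI nzI.
have [g nzg] := component_neq0 gB nzx.
have [c [j [Ec homj xc]]] := homogeneous_fraction (component_homogeneous gB x g).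
have Ij : I (phi j) by rewrite -xc; apply: mulI; apply: clI.
have nzj : j != 0.
  rewrite -phi_neq0 -xc; apply: contraNneq nzg => xc0; apply/eqP.
  by apply: (mulIr (phi_unit Ec)); rewrite mul0r.
pose J := [set r | I (phi r)].
have grJ : graded_right_ideal A J.
  split; first split; first split.
  - by rewrite /J /= rmorph0; apply: subgroup0.
  - by move=> v w; rewrite /J /= rmorphB; apply: subgroupB.
  - by move=> v r Jv; rewrite /J /= rmorphM; apply: mulI.
  by move=> v h /(clI _ h); rewrite phi_component.
have [|d Id Ed] := essential_has_regular gA primeA goldieA grJ.
  move=> y homy nzy; have [z homz nz] := gr_prime_elements gA primeA homy homj nzy nzj.
  exists (z * j); rewrite mulrA; split=> //.
  by rewrite /J /= rmorphM; apply: lmulI.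
apply/seteqP; split=> // q _; rewrite -[q](divrK (phi_unit Ed)).
exact: lmulI.
Qed.

End FractionGrading.

Theorem theorem1 (G : zmodType) (R : pzRingType) (A : G -> set R) :
  is_grading A -> gr_prime A -> right_gr_goldie A ->
  [/\ right_denominator_set (homogeneous_regular A),
      exists (Q : unitRingType) (phi : {rmorphism R -> Q}),
        right_ring_of_fractions (homogeneous_regular A) phi
    & forall (Q : unitRingType) (phi : {rmorphism R -> Q}),
        right_ring_of_fractions (homogeneous_regular A) phi ->
        exists B : G -> set Q,
          [/\ is_grading B,
              extends_grading phi A B,
              forall B' : G -> set Q,
                is_grading B' -> extends_grading phi A B' -> B' = B,
              gr_simple B
            & gr_artinian B]].
Proof.
move=> gA primeA goldieA.
have denA := regular_denominators gA primeA goldieA.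
split=> // [|Q phi fracQ].
  by apply: fractions_exist => //; [move=> c [] | apply: one_neq0 primeA].
exists (fraction_grading A phi); split.
- exact: fraction_grading_is_grading.
- exact: fraction_grading_extends.
- exact: fraction_grading_unique.
- exact: fraction_simple.
- apply: semisimple_artinian; first exact: fraction_grading_is_grading.
  exact: fraction_semisimple.
Qed.
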